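(* Let $X\in\mathbb{C}^{d\times d}$. Then the Neumann series $\sum_{k=0}^\infty X^k$ is Cesàro summable to $(I-X)^{-1}$ if and only if $\lambda(X)\subseteq\overline{\mathbb{D}}\setminus\{1\}$ and the geometric and algebraic multiplicities are equal for each eigenvalue in $\lambda(X)\cap\partial\mathbb{D}\setminus\{1\}$.
   Context: $\lambda(X)$ is the set of eigenvalues of $X$; $\mathbb{D}=\{z\in\mathbb{C}:|z|<1\}$, with closure $\overline{\mathbb{D}}$ and boundary $\partial\mathbb{D}$. For a sequence $(A_k)_{k=0}^\infty$ in $\mathbb{C}^{d\times d}$ put $S_n=\sum_{k=0}^n A_k$ and $\Sigma_n=\frac1n\sum_{k=0}^{n-1}S_k$ for $n\ge 1$. The series $\sum_{k=0}^\infty A_k$ is Cesàro summable to $S\in\mathbb{C}^{d\times d}$ if $\lim_{n\to\infty}\Sigma_n=S$ (in any matrix norm). The assertion that the series is summable to $(I-X)^{-1}$ is understood to include that $I-X$ is invertible. *)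

(* Defs.v *)
From HB Require Import structures.
From mathcomp Require Import all_boot all_order all_algebra.
From mathcomp Require Import complex.
From mathcomp Require Import all_classical all_reals all_analysis.

Set Implicit Arguments.
Unset Strict Implicit.
Unset Printing Implicit Defensive.

Import Order.TTheory GRing.Theory Num.Theory.
Import numFieldNormedType.Exports.

Local Open Scope classical_set_scope.
Local Open Scope complex_scope.
Local Open Scope ring_scope.

(* The library topology of a [numClosedFieldType] (induced by its norm) is found
   on a structure such as [CC R], but not on the bare carrier [R[i]]. *)
Definition CC (R : realType) : numClosedFieldType := R[i].

Definition unit_disc (R : realType) : set (CC R) := [set z | `|z| < 1].
Arguments unit_disc : clear implicits.

Definition boundary (T : topologicalType) (A : set T) : set T :=
  closure A `\` interior A.

Definition partial_sum (R : realType) (d : nat) (A : nat -> 'M[CC R]_d)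
  (n : nat) : 'M[CC R]_d := \sum_(0 <= k < n.+1) A k.

(* Meaningful for n >= 1; the value at n = 0 is the junk value 0. *)
Definition cesaro_mean (R : realType) (d : nat) (A : nat -> 'M[CC R]_d)
  (n : nat) : 'M[CC R]_d := n%:R^-1 *: \sum_(0 <= k < n) partial_sum A k.

(* The library topology on matrices is that of entrywise convergence, which is
   the topology of every matrix norm. *)
Definition cesaro_summable (R : realType) (d : nat) (A : nat -> 'M[CC R]_d)
  (S : 'M[CC R]_d) : Prop := cesaro_mean A n @[n --> \oo] --> S.

Definition spectrum (R : realType) (d : nat) (X : 'M[CC R]_d) : set (CC R) :=
  [set a | eigenvalue X a].

(* [eigenspace] consists of row vectors, v *m X = a *: v; its dimension
   d - \rank (X - a%:M) is also that of the space of column eigenvectors. *)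
Definition geometric_multiplicity (R : realType) (d : nat) (X : 'M[CC R]_d)
  (a : CC R) : nat := \rank (eigenspace X a).

Definition algebraic_multiplicity (R : realType) (d : nat) (X : 'M[CC R]_d)
  (a : CC R) : nat := mup a (char_poly X).

(* Main.v *)
Require Import Defs.
From HB Require Import structures.
From mathcomp Require Import all_boot all_order all_algebra.
From mathcomp Require Import complex.
From mathcomp Require Import all_classical all_reals all_analysis.
From mathcomp Require Import ring.

Import Order.TTheory GRing.Theory Num.Theory.
Import numFieldNormedType.Exports.

Local Open Scope classical_set_scope.
Local Open Scope ring_scope.

(** Put Y = 1 - X. Once Y is invertible, telescoping twice shows that the sum of
    the first n partial sums differs from n Y^-1 by Y^-2 (X^(n+1) - X)
    ([cesaro_sum_identity]). Dividing by n, the series is Cesaro summable to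
    Y^-1 exactly when X^n = o(n) entrywise ([cesaro_summable_neumann]), and Y is
    invertible exactly when 1 is not an eigenvalue. What remains is a statement
    about powers ([sublinear_powers_spectrum]): X^n = o(n) iff every eigenvalue a
    has |a| <= 1 and those with |a| = 1 have no Jordan chain of length 2.

    If v is an eigenvector for a then v X^n = a^n v, which by the Bernoulli
    inequality is not o(n) when |a| > 1. If |a| = 1 and w, v is a Jordan chain,
    then w X^n contains the term n a^(n-1) v, which is of exact order n.
    Conversely every row vector is a sum of generalised eigenvectors
    ([primary_ind]). For |a| < 1 the orbit of a generalised eigenvector is
    o(n) by induction on its order: v X^n solves a recursion
    u_(n+1) = a u_n + o(n), and a contraction keeps such a u in o(n)
    ([sublinear_rec]). For |a| = 1 there are only eigenvectors, with bounded
    orbits.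

    Finally the multiplicity condition is the absence of Jordan chains
    ([semisimple_at_mup]): in a basis that starts with a basis of the
    eigenspace, of dimension g, X is block triangular with diagonal blocks a I
    and C, so the algebraic multiplicity is g plus that of a in C, and an
    eigenvector of C for a is the same thing as a Jordan chain of X. *)

(** * Multiplicities and Jordan chains *)

Lemma char_poly_conj (F : fieldType) (n : nat) (P A B : 'M[F]_n) :
  P \in unitmx -> P *m A = B *m P -> char_poly A = char_poly B.
Proof.
move=> Pu eqAB; have Pdet : (\det P)%:P != 0 :> {poly F}.
  by rewrite polyC_eq0 -unitfE -unitmxE.
apply: (mulfI Pdet); rewrite [RHS]mulrC /char_poly -det_map_mx -!det_mulmx.
congr (\det _); rewrite /char_poly_mx mulmxBr mulmxBl -!map_mxM eqAB.
by rewrite mul_mx_scalar mul_scalar_mx.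
Qed.

Lemma char_poly_lblock (F : fieldType) (g e : nat) (a : F) (B : 'M[F]_(e, g))
    (C : 'M[F]_e) :
  char_poly (block_mx a%:M 0 B C) = ('X - a%:P) ^+ g * char_poly C.
Proof.
rewrite /char_poly /char_poly_mx map_block_mx scalar_mx_block opp_block_mx.
rewrite add_block_mx map_mx0 subr0 sub0r det_lblock; congr (_ * _).
by rewrite map_scalar_mx -raddfB det_scalar.
Qed.

Lemma mup_char_poly_lblock (F : fieldType) (g e : nat) (a : F)
    (B : 'M[F]_(e, g)) (C : 'M[F]_e) :
  mup a (char_poly (block_mx a%:M 0 B C)) = (g + mup a (char_poly C))%N.
Proof.
rewrite char_poly_lblock mupM ?expf_neq0 ?polyXsubC_eq0 //.
  by rewrite mup_XsubCX eqxx.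
exact: monic_neq0 (char_poly_monic C).
Qed.

(** The rows of P extend a basis of the eigenspace. The last clause says that
    the eigenspace is no larger than the span of the first g rows; this is what
    forbids an eigenvector for a of the block form of X from having a nonzero
    part in the last e coordinates. *)
Lemma eigenvector_basis (F : fieldType) (g e : nat) (X : 'M[F]_(g + e))
    (a : F) : \rank (eigenspace X a) = g ->
  exists P (B : 'M[F]_(e, g)) C,
    [/\ P \in unitmx, P *m X = block_mx a%:M 0 B C *m P
      & forall w : 'rV_(g + e), w *m X = a *: w -> rsubmx (w *m invmx P) = 0].
Proof.
move=> rkX; set N := X - a%:M; have rkN : \rank (kermx N) = g by [].
pose P := row_ebase (kermx N); pose L := col_ebase (kermx N).
have Pu : P \in unitmx by exact: row_ebase_unit.
have Lu : L \in unitmx by exact: col_ebase_unit.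
have eL : L *m pid_mx g *m P = kermx N by rewrite -[RHS]mulmx_ebase rkN.
pose Z := P *m X *m invmx P.
have PX : P *m X = Z *m P by rewrite mulmxKV.
(* The first g rows of P are killed by N because, up to the invertible L, they
   are the rows of the kernel. *)
have pidPN : pid_mx g *m P *m N = 0 :> 'M[F]_(g + e).
  by rewrite -[LHS](mulKmx Lu) (mulmxA L) (mulmxA L) eL mulmx_ker mulmx0.
have pidZ : pid_mx g *m Z = a *: pid_mx g :> 'M[F]_(g + e).
  move: pidPN; rewrite mulmxBr -!mulmxA PX mul_mx_scalar => /eqP.
  rewrite subr_eq0 => /eqP /(congr1 (mulmx^~ (invmx P))).
  by rewrite -scalemxAr -scalemxAl -!mulmxA mulmxV ?mulmx1 // /Z -!mulmxA.
move: pidZ; rewrite -[Z]submxK (pid_mx_block _ e e g) mulmx_block.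
rewrite !mul1mx !mul0mx !addr0 scale_block_mx !scaler0 => /eq_block_mx[eul eur _ _].
exists P, (dlsubmx Z), (drsubmx Z); split => //.
  by rewrite PX -{1}[Z]submxK eul eur scalemx1.
move=> w wX; have /sub_kermxP/submxP[y ->] : w *m N = 0.
  by rewrite mulmxBr wX mul_mx_scalar subrr.
rewrite -eL !mulmxA mulmxK // (pid_mx_block _ e e g) -[y *m L]hsubmxK.
by rewrite mul_row_block !mulmx0 !addr0 row_mxKr.
Qed.

(** The condition ker (X - a)^2 = ker (X - a); it holds when a is not an
    eigenvalue. *)
Definition semisimple_at (F : fieldType) (d : nat) (X : 'M[F]_d) (a : F) :=
  forall w : 'rV_d,
    w *m (X - a%:M) *m (X - a%:M) = 0 -> w *m (X - a%:M) = 0.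
Arguments semisimple_at {F d} X a.

(** In the basis of [eigenvector_basis], D = X - a has first block row 0, so a row
    (u1, u2) is mapped to (u2 B, u2 (C - a)). If C - a is injective, two
    applications of D giving 0 force u2 = 0. If u (C - a) = 0 with u nonzero,
    then (0, u) is mapped to (u B, 0), which D kills, while (0, u) is not itself
    in the eigenspace. *)
Lemma semisimple_at_mup (F : fieldType) (d : nat) (X : 'M[F]_d) (a : F) :
  \rank (eigenspace X a) = mup a (char_poly X) <-> semisimple_at X a.
Proof.
move rkX: (\rank (eigenspace X a)) => g.
have [e de] : exists e, d = (g + e)%N.
  by exists (d - g)%N; rewrite subnKC // -rkX rank_leq_row.
subst d.
have [P [B [C [Pu PX kerP]]]] := eigenvector_basis _ _ _ _ _ rkX.
rewrite (char_poly_conj _ _ _ _ _ Pu PX) mup_char_poly_lblock.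
pose D : 'M[F]_(g + e) := block_mx 0 0 B (C - a%:M).
have PN : P *m (X - a%:M) = D *m P.
  rewrite mulmxBr PX mul_mx_scalar -mul_scalar_mx -mulmxBl; congr (_ *m _).
  by rewrite scalar_mx_block opp_block_mx add_block_mx !subrr !subr0.
have rowD (u1 : 'rV_g) (u2 : 'rV_e) :
    row_mx u1 u2 *m D = row_mx (u2 *m B) (u2 *m (C - a%:M)).
  by rewrite mul_row_block !mulmx0 !add0r.
have chainE (w : 'rV_(g + e)) : w *m P *m (X - a%:M) = w *m D *m P.
  by rewrite -mulmxA PN mulmxA.
have P0 (w : 'rV_(g + e)) : w *m P = 0 -> w = 0.
  by move=> wP; rewrite -[w](mulmxK Pu) wP mul0mx.
split=> [/eqP|ss].
  rewrite -[X in X == _]addn0 eqn_add2l eq_sym => /eqP mupC w.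
  have Cinj (u : 'rV_e) : u *m (C - a%:M) = 0 -> u = 0.
    move=> uC; apply/eqP; apply: contraPT mupC => u0.
    apply/eqP; rewrite -lt0n -XsubC_dvd ?monic_neq0 ?char_poly_monic //.
    rewrite -root_factor_theorem -eigenvalue_root_char.
    apply/eigenvalueP; exists u => //; apply/eqP; rewrite -subr_eq0.
    by rewrite -mul_mx_scalar -mulmxBr uC.
  rewrite -[w](mulmxKV Pu); move: (w *m _) => {}w.
  rewrite chainE chainE => /P0; rewrite -[w]hsubmxK !rowD.
  rewrite -[0]row_mx0 => /eq_row_mx[_ /Cinj/Cinj ->].
  by rewrite !mul0mx row_mx0 mul0mx.
rewrite mupNroot ?addn0 // -eigenvalue_root_char.
apply/negP => /eigenvalueP[u uC]; apply/negP; rewrite negbK.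
have uCa : u *m (C - a%:M) = 0 by rewrite mulmxBr uC mul_mx_scalar subrr.
pose w : 'rV_(g + e) := row_mx 0 u.
have : w *m P *m (X - a%:M) = 0.
  apply: ss; rewrite !chainE !rowD uCa mul0mx mul0mx.
  by rewrite row_mx0 mul0mx.
rewrite mulmxBr mul_mx_scalar => /eqP; rewrite subr_eq0 => /eqP /kerP.
by rewrite mulmxK // row_mxKr => ->.
Qed.

(** * Scalar sequences of growth o(n) *)

(** u n = o(n), written with a bound valid for every n: the constant absorbs the
    initial terms, so that sums and recursions need no threshold. *)
Definition sublinear_seq (K : numFieldType) (u : nat -> K) :=
  forall e, 0 < e -> exists c, forall n, `|u n| <= c + e * n%:R.
Arguments sublinear_seq {K} u.

Lemma sublinear_cst (K : numFieldType) (c : K) : sublinear_seq (fun=> c).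
Proof.
by move=> e e0; exists `|c| => n; rewrite lerDl mulr_ge0 ?ler0n ?ltW.
Qed.

Lemma sublinearD (K : numFieldType) (u v : nat -> K) :
  sublinear_seq u -> sublinear_seq v -> sublinear_seq (fun n => u n + v n).
Proof.
move=> su sv e e0; have e20 : 0 < e / 2 by rewrite divr_gt0.
have [c hu] := su _ e20; have [c' hv] := sv _ e20.
exists (c + c') => n; apply: le_trans (ler_normD _ _) _.
by rewrite {1}(splitr e) mulrDl addrACA lerD.
Qed.

Lemma sublinearM (K : numFieldType) (a : K) (u : nat -> K) :
  sublinear_seq u -> sublinear_seq (fun n => a * u n).
Proof.
move=> su e e0; have a0 : 0 < `|a| + 1 by rewrite ltr_wpDl.
have [c hu] := su _ (divr_gt0 e0 a0).
exists ((`|a| + 1) * c) => n; rewrite normrM.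
apply: (@le_trans _ _ ((`|a| + 1) * `|u n|)).
  by rewrite ler_wpM2r // lerDl.
rewrite (le_trans (ler_wpM2l (ltW a0) (hu n))) // mulrDr mulrA.
by rewrite [_ * (e / _)]mulrC divfK ?gt_eqF.
Qed.

Lemma sublinear_sum (K : numFieldType) (I : finType) (u : I -> nat -> K) :
  (forall i, sublinear_seq (u i)) -> sublinear_seq (fun n => \sum_i u i n).
Proof.
move=> su; elim: (index_enum I) => [|i s IHs].
  by under eq_fun do rewrite big_nil; exact: sublinear_cst.
by under eq_fun do rewrite big_cons; exact: sublinearD.
Qed.

Lemma sublinear_shift (K : numFieldType) (u : nat -> K) :
  sublinear_seq (fun n => u n.+1) -> sublinear_seq u.
Proof.
move=> su e e0; have [c hu] := su e e0; exists (`|u 0%N| + c) => -[|n].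
  have c0 : 0 <= c by have := hu 0%N; rewrite mulr0 addr0; apply: le_trans.
  by rewrite mulr0 addr0 lerDl.
apply: (le_trans (hu n)); rewrite -addrA ler_wpDl // lerD2l.
by rewrite ler_pM2l // ler_nat leqnSn.
Qed.

(** With v n = u n.+1 - a * u n bounded by c + (1 - |a|) e n, the bound
    |u n| <= |u 0| + c / (1 - |a|) + e n is preserved by the recursion. *)
Lemma sublinear_rec (K : numFieldType) (a : K) (u : nat -> K) :
  `|a| < 1 -> sublinear_seq (fun n => u n.+1 - a * u n) -> sublinear_seq u.
Proof.
move=> a1 sv e e0; pose r := 1 - `|a|; have r0 : 0 < r by rewrite subr_gt0.
have [c hv] := sv _ (mulr_gt0 r0 e0).
have c0 : 0 <= c by have := hv 0%N; rewrite mulr0 addr0; apply: le_trans.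
exists (`|u 0%N| + c / r); elim=> [|n IHn].
  by rewrite mulr0 addr0 lerDl divr_ge0 // ltW.
rewrite -[u n.+1](subrK (a * u n)); apply: le_trans (ler_normD _ _) _.
rewrite normrM; apply: le_trans (lerD (hv n) (ler_wpM2l (normr_ge0 a) IHn)) _.
have -> : `|a| = 1 - r by rewrite /r; ring.
rewrite -subr_ge0.
have -> : `|u 0%N| + c / r + e * n.+1%:R -
   (c + r * e * n%:R + (1 - r) * (`|u 0%N| + c / r + e * n%:R))
   = r * `|u 0%N| + e by rewrite -natr1; field; rewrite gt_eqF.
by rewrite ltW // ltr_wpDl // mulr_ge0 // ltW.
Qed.

Lemma complex_archimedean (R : realType) (y : CC R) :
  ~ (forall n, n%:R <= y).
Proof.
move=> hy; have := hy (Num.bound (complex.Re y)).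
rewrite -(rmorph_nat (real_complex R)) lecE /= => /andP[_].
apply/negP; rewrite -ltNge archi_boundP //.
by have := hy 0%N; rewrite lecE /= => /andP[].
Qed.

(** The error c is there for Jordan chains, along which an orbit grows linearly
    only up to a bounded term. *)
Lemma linear_growth_not_sublinear (R : realType) (x c : CC R) (u : nat -> CC R) :
  0 < x -> (forall n, n%:R * x - c <= `|u n|) -> ~ sublinear_seq u.
Proof.
move=> x0 hu su; have x20 : 0 < x / 2 by rewrite divr_gt0.
have [c' hc'] := su _ x20.
apply: (@complex_archimedean _ ((c + c') / (x / 2))) => n.
rewrite ler_pdivlMr // -subr_ge0.
have -> : c + c' - n%:R * (x / 2) = c' + x / 2 * n%:R - (n%:R * x - c) by field.
by rewrite subr_ge0; exact: le_trans (hu n) (hc' n).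
Qed.

Lemma sublinear_exp_le1 (R : realType) (a z : CC R) :
  z != 0 -> sublinear_seq (fun n => a ^+ n * z) -> `|a| <= 1.
Proof.
move=> z0 su; rewrite real_leNgt ?normr_real //; apply/negP => a1.
have h0 : 0 < `|a| - 1 by rewrite subr_gt0.
apply: (@linear_growth_not_sublinear R ((`|a| - 1) * `|z|) 0 _ _ _ su).
  by rewrite mulr_gt0 ?normr_gt0.
move=> n; rewrite subr0 normrM mulrA ler_wpM2r // normrX.
(* Bernoulli's inequality makes geometric growth at least linear. *)
suff: 1 + n%:R * (`|a| - 1) <= `|a| ^+ n by apply: le_trans; rewrite lerDr.
elim: n => [|n IHn]; first by rewrite mul0r addr0 expr0.
rewrite exprS; apply: le_trans (ler_wpM2l (normr_ge0 a) IHn).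
rewrite -subr_ge0 -natr1.
have -> : `|a| * (1 + n%:R * (`|a| - 1)) - (1 + (n%:R + 1) * (`|a| - 1))
  = n%:R * (`|a| - 1) ^+ 2 by ring.
by rewrite mulr_ge0 ?ler0n // exprn_ge0 // ltW.
Qed.

Lemma cvg_div_sublinear (R : realType) (u : nat -> CC R) (l : CC R) :
  (n%:R^-1 * u n @[n --> \oo] --> l) <->
  sublinear_seq (fun n => u n - n%:R * l).
Proof.
split=> [/cvgrPdistC_lt cu e e0|su].
  have [N _ hN] := cu e e0.
  (* A sum, not a maximum, absorbs the initial terms: the order is partial. *)
  exists (\sum_(k < N.+1) `|u k - k%:R * l|) => n.
  have [nN|Nn] := ltnP n N.+1.
    rewrite (bigD1 (Ordinal nN)) //= -addrA lerDl addr_ge0 ?sumr_ge0 //.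
    by rewrite mulr_ge0 ?ler0n ?ltW.
  have n0' : n%:R != 0 :> CC R by rewrite pnatr_eq0 -lt0n (leq_trans _ Nn).
  rewrite ler_wpDl ?sumr_ge0 //.
  rewrite -[u n](mulVKf n0') -mulrBr normrM normr_nat mulrC.
  by rewrite ler_wpM2r ?ler0n // ltW //; apply: hN; exact: ltnW.
apply/cvgrPdistC_le => e e0.
have e20 : 0 < e / 2 by rewrite divr_gt0.
have [c hc] := su _ e20.
have [N hN] : exists N, c <= e / 2 * N%:R.
  have c0 : 0 <= c by have := hc 0%N; rewrite mulr0 addr0; apply: le_trans.
  apply: contrapT => /forallNP hN; apply: (@complex_archimedean _ (c / (e / 2))).
  move=> m; rewrite ler_pdivlMr // mulrC ltW // real_ltNge ?ger0_real //.
    exact/negP.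
  by rewrite mulr_ge0 ?ler0n ?ltW.
exists N.+1 => // n /= Nn.
have n0 : (0 < n)%N by apply: leq_trans Nn.
have n0' : n%:R != 0 :> CC R by rewrite pnatr_eq0 -lt0n.
have -> : n%:R^-1 * u n - l = n%:R^-1 * (u n - n%:R * l).
  by rewrite mulrBr mulKf.
rewrite normrM normfV normr_nat ler_pdivrMl ?ltr0n //.
apply: le_trans (hc n) _; rewrite [n%:R * e]mulrC {2}(splitr e) mulrDl lerD2r.
by rewrite (le_trans hN) // ler_pM2l // ler_nat ltnW.
Qed.

(** * Matrix sequences and Cesaro means *)

Definition sublinear_mx (K : numFieldType) (m n : nat)
    (U : nat -> 'M[K]_(m, n)) :=
  forall i j, sublinear_seq (fun k => U k i j).
Arguments sublinear_mx {K m n} U.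

Lemma sublinear_mx_ext (K : numFieldType) (m n : nat)
    (U V : nat -> 'M[K]_(m, n)) :
  (forall k, U k = V k) -> sublinear_mx U -> sublinear_mx V.
Proof. by move=> UV sU i j; under eq_fun do rewrite -UV; exact: sU. Qed.

Lemma sublinear_mx_cst (K : numFieldType) (m n : nat) (A : 'M[K]_(m, n)) :
  sublinear_mx (fun=> A).
Proof. by move=> i j; exact: sublinear_cst. Qed.

Lemma sublinear_mxD (K : numFieldType) (m n : nat)
    (U V : nat -> 'M[K]_(m, n)) :
  sublinear_mx U -> sublinear_mx V -> sublinear_mx (fun k => U k + V k).
Proof.
move=> sU sV i j; under eq_fun do rewrite mxE.
exact: sublinearD (sU i j) (sV i j).
Qed.

Lemma sublinear_mxM (K : numFieldType) (m n p : nat) (A : 'M[K]_(m, n))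
    (U : nat -> 'M[K]_(n, p)) :
  sublinear_mx U -> sublinear_mx (fun k => A *m U k).
Proof.
move=> sU i j; under eq_fun do rewrite mxE.
by apply: sublinear_sum => l; exact: sublinearM.
Qed.

Lemma cvg_mx_entrywise (K : numFieldType) (m n : nat)
    (U : nat -> 'M[K]_(m, n)) (A : 'M[K]_(m, n)) :
  (U k @[k --> \oo] --> A) <->
  (forall i j, U k i j @[k --> \oo] --> A i j).
Proof.
split=> [cU i j|cU B [P nP PB]].
  exact: (cvg_comp _ _ cU (@coord_continuous K m n i j A)).
apply: (@filterS _ _ _ (fun k => forall i j, P i j (U k i j))).
  by move=> k Pk; exact: PB.
have := @filter_forall _ _ (fun i k => forall j, P i j (U k i j)) \oo _; apply => i.
have := @filter_forall _ _ (fun j k => P i j (U k i j)) \oo _; apply => j.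
exact: cU.
Qed.

Lemma cvg_mx_sublinear (R : realType) (d : nat) (U : nat -> 'M[CC R]_d)
    (A : 'M[CC R]_d) :
  (n%:R^-1 *: U n @[n --> \oo] --> A) <->
  sublinear_mx (fun n => U n - A *+ n).
Proof.
have entryE i j : (fun n => (U n - A *+ n) i j) =
    (fun n => U n i j - n%:R * A i j).
  by apply/funext => n; rewrite !mxE mulmxnE mulr_natl.
have scaleE i j : (fun n : nat => (n%:R^-1 *: U n) i j) =
    (fun n => n%:R^-1 * U n i j).
  by apply/funext => n; rewrite mxE.
rewrite cvg_mx_entrywise; split=> cU i j.
  by rewrite entryE; apply/cvg_div_sublinear; rewrite -scaleE; exact: cU.
by rewrite scaleE; apply/cvg_div_sublinear; rewrite -entryE; exact: cU.
Qed.

(** Multiplying a partial sum by Y = 1 - X telescopes it to 1 - X^(k+1), and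
    multiplying the sum of those by Y telescopes once more. *)
Lemma cesaro_sum_identity (R : realType) (d : nat) (X : 'M[CC R]_d)
    (n : nat) :
  let Y : 'M[CC R]_d := 1%:M - X in
  Y *m (Y *m \sum_(0 <= k < n) partial_sum (fun k => X ^+ k) k) =
  Y *+ n + (X ^+ n.+1 - X).
Proof.
rewrite /= !mulmxE; set Y : 'M[CC R]_d := 1%:M - X.
have Y_partial k : Y * partial_sum (fun k => X ^+ k) k = 1 - X ^+ k.+1.
  rewrite /partial_sum big_mkord -opprB subrX1 -mulNr opprB.
  by rewrite /Y.
elim: n => [|n IHn]; first by rewrite big_nil !mulr0 expr1 subrr addr0.
rewrite big_nat_recr //= !mulrDr IHn Y_partial mulrSr !mulrBr mulr1.
rewrite (exprS X n.+1) {3}/Y mulrBl mul1r.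
by rewrite addrACA opprB; congr (_ + _); rewrite addrC addrA subrK.
Qed.

(** By [cesaro_sum_identity], n times the error of the n-th Cesaro mean and
    X^(n+1) - X determine each other through multiplication by the fixed
    invertible matrix (1 - X)^2. *)
Lemma cesaro_summable_neumann (R : realType) (d : nat) (X : 'M[CC R]_d) :
  1%:M - X \in unitmx ->
  cesaro_summable (fun k => X ^+ k) (invmx (1%:M - X)) <->
  sublinear_mx (fun n => X ^+ n).
Proof.
set Y := 1%:M - X => Yu; rewrite /cesaro_summable /cesaro_mean.
rewrite (cvg_mx_sublinear _ _ (fun n => \sum_(0 <= k < n) _)).
set U := fun n => _ - _.
have YYU n : Y *m (Y *m U n) = X ^+ n.+1 - X.
  rewrite /U !mulmxBr cesaro_sum_identity -/Y.
  have YV : Y * invmx Y = 1 by exact: mulmxV.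
  by rewrite !mulmxE mulrnAr YV mulrnAr mulr1 addrC addKr.
have UE n : invmx Y *m (invmx Y *m (X ^+ n.+1 - X)) = U n.
  by rewrite -YYU !mulKmx.
split=> sU.
  move=> i j; apply: sublinear_shift; move: i j.
  apply: (@sublinear_mx_ext _ _ _ (fun n => Y *m (Y *m U n) + X)).
    by move=> n; rewrite YYU subrK.
  by apply: sublinear_mxD; [do 2!apply: sublinear_mxM | exact: sublinear_mx_cst].
apply: (sublinear_mx_ext _ _ _ _ _ UE); do 2!apply: sublinear_mxM.
apply: sublinear_mxD; last exact: sublinear_mx_cst.
by under eq_fun do rewrite exprS -mulmxE; exact: sublinear_mxM.
Qed.

(** * The unit disc *)

Lemma closure_unit_disc (R : realType) :
  closure (unit_disc R) = [set z | `|z| <= 1].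
Proof.
apply/seteqP; split=> z /=.
  move=> clz; rewrite real_leNgt ?normr_real //; apply/negP => z1.
  have e0 : 0 < `|z| - 1 by rewrite subr_gt0.
  have [w [w1]] := clz _ (nbhsx_ballx z _ e0).
  rewrite -ball_normE /= => zw; have : `|z| < `|z|; last by rewrite ltxx.
  rewrite -{1}[z](subrK w); apply: le_lt_trans (ler_normD _ _) _.
  by rewrite -[ltRHS](subrK 1) ltrD.
move=> z1 B /nbhs_ballP[e /= e0 eB].
have e10 : 0 < e + 1 by rewrite ltr_wpDl // ltW.
(* Shrinking z by the factor 1 - t, with t < e, moves it by less than e and into
   the open disc. *)
pose t := e / (e + 1).
have t0 : 0 < t by rewrite divr_gt0.
have t1 : t < 1 by rewrite ltr_pdivrMr // mul1r ltrDl.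
have te : t < e by rewrite ltr_pdivrMr // ltr_pMr // ltrDr.
exists ((1 - t) * z); split.
  rewrite /unit_disc /= normrM ger0_norm ?subr_ge0 ?(ltW t1) //.
  apply: (@le_lt_trans _ _ (1 - t)); last by rewrite ltrBlDr ltrDl.
  by rewrite ler_piMr // subr_ge0 ltW.
apply: eB; rewrite -ball_normE /=.
have -> : z - (1 - t) * z = t * z by ring.
rewrite normrM (gtr0_norm t0); apply: le_lt_trans te.
by rewrite ler_piMr // ltW.
Qed.

Lemma open_unit_disc (R : realType) : open (unit_disc R).
Proof.
rewrite openE => z z1; apply/nbhs_ballP; exists (1 - `|z|).
  by rewrite /= subr_gt0.
move=> w; rewrite -ball_normE /= => zw; rewrite /unit_disc /=.
rewrite -[w](subrK z); apply: le_lt_trans (ler_normD _ _) _.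
by rewrite distrC -ltrBrDr.
Qed.

Lemma boundary_unit_disc (R : realType) :
  boundary (unit_disc R) = [set z | `|z| = 1].
Proof.
rewrite /boundary closure_unit_disc (interior_id _).1; last exact: open_unit_disc.
apply/seteqP; split=> z /=; last first.
  by rewrite /unit_disc /= => ->; split; rewrite // ltxx.
move=> [z1 /negP]; rewrite /unit_disc /= => nz1; apply/eqP.
by rewrite eq_le z1 /= real_leNgt ?normr_real.
Qed.

(** * Growth of powers *)

(** Primary decomposition as an induction principle: to prove an additive
    property of all row vectors, it is enough to treat those killed by a power
    of X - a for a single eigenvalue a. The characteristic polynomial kills
    everything, and splitting off all factors X - a for one root a at a time
    leaves coprime factors, whose kernels add up. *)
Lemma primary_ind (F : closedFieldType) (d : nat) (X : 'M[F]_d)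
    (P : 'rV[F]_d -> Prop) :
  P 0 -> (forall u v, P u -> P v -> P (u + v)) ->
  (forall a m v, eigenvalue X a -> (v <= kermxpoly X (('X - a%:P) ^+ m))%MS ->
     P v) ->
  forall v, P v.
Proof.
move=> P0 PD Pprim v; case: d X P P0 PD Pprim v => [|d] X P P0 PD Pprim v.
  by rewrite thinmx0.
have Pker k (p : {poly F}) : (size p <= k)%N -> p != 0 ->
    (forall a, root p a -> eigenvalue X a) ->
    forall u : 'rV_d.+1, (u <= kermxpoly X p)%MS -> P u.
  elim: k p => [|k IHk] p; first by rewrite leqn0 size_poly_eq0 => ->.
  move=> szp p0 rp u up; have [szp1|] := eqVneq (size p) 1%N.
    have /size_poly1P[c c0 pc] : size p == 1%N by exact/eqP.
    by move: up; rewrite pc kermxpolyC // => /submx0null ->.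
  move=> /closed_rootP[a ra].
  have [[|m] [q qa pE]] := multiplicity_XsubC p a.
    by move: ra qa; rewrite p0 pE expr0 mulr1 => ->.
  have {qa} qa : ~~ root q a by move: qa; rewrite p0.
  have q0 : q != 0 by apply: contraNneq p0 => q0; rewrite pE q0 mul0r.
  have cop : coprimep q (('X - a%:P) ^+ m.+1).
    by rewrite coprimep_expr // coprimep_XsubC.
  have /sub_addsmxP[[u1 u2] /= ->] :
      (u <= kermxpoly X q + kermxpoly X (('X - a%:P) ^+ m.+1))%MS.
    by rewrite -(kermxpolyM X cop) -pE.
  apply: PD; last by apply: (Pprim a m.+1); rewrite ?rp // submxMl.
  apply: (IHk q); rewrite ?submxMl //; last first.
    by move=> b qb; apply: rp; rewrite pE rootM qb.
  rewrite -ltnS (leq_trans _ szp) // pE size_Mmonic // ?monic_exp ?monicXsubC //.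
  by rewrite size_exp_XsubC !addnS /= ltnS leq_addr.
apply: (Pker _ (char_poly X) (leqnn _)).
- exact: monic_neq0 (char_poly_monic X).
- by move=> a; rewrite eigenvalue_root_char.
- by apply/sub_kermxP; rewrite Cayley_Hamilton mulmx0.
Qed.

Lemma kermxpoly_XsubCX (F : fieldType) (k d m : nat) (X : 'M[F]_d) (a : F)
    (v : 'M[F]_(k, d)) :
  (v <= kermxpoly X (('X - a%:P) ^+ m))%MS <-> v *m (X - a%:M) ^+ m = 0.
Proof.
case: d X v => [|d] X v; first by rewrite !thinmx0 sub0mx; split.
rewrite /kermxpoly rmorphXn rmorphB /= horner_mx_X horner_mx_C.
by split=> /sub_kermxP.
Qed.

Lemma eigenvector_orbit (F : fieldType) (d : nat) (X : 'M[F]_d) (a : F)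
    (v : 'rV[F]_d) (n : nat) :
  v *m X = a *: v -> v *m X ^+ n = a ^+ n *: v.
Proof.
move=> vX; elim: n => [|n IHn]; first by rewrite !expr0 mulmx1 scale1r.
by rewrite exprS -mulmxE mulmxA vX -scalemxAl IHn scalerA -exprS.
Qed.

(** The expansion w X^n = a^n w + n a^(n-1) v, multiplied by a so that it has no
    exceptional case n = 0. *)
Lemma jordan_chain_orbit (F : fieldType) (d : nat) (X : 'M[F]_d) (a : F)
    (w v : 'rV[F]_d) (n : nat) :
  w *m X = a *: w + v -> v *m X = a *: v ->
  a *: (w *m X ^+ n) = a ^+ n *: (a *: w + n%:R *: v).
Proof.
move=> wX vX; elim: n => [|n IHn].
  by rewrite !expr0 mulmx1 scale1r scale0r addr0.
rewrite exprSr -mulmxE mulmxA scalemxAl IHn -scalemxAl mulmxDl -scalemxAl wX.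
rewrite exprSr -scalerA -natr1; congr (_ *: _).
rewrite -scalemxAl vX !scalerDr -!addrA scalerDl scale1r !scalerDr !scalerA.
by rewrite [n%:R * a]mulrC [a *: v + _]addrC.
Qed.

(** Induction on m: the sequence v (X - a) X^n, sublinear by induction, is the
    defect v X^(n+1) - a v X^n to which [sublinear_rec] applies. *)
Lemma sublinear_row_inner (R : realType) (d m : nat) (X : 'M[CC R]_d)
    (a : CC R) (v : 'rV[CC R]_d) :
  `|a| < 1 -> v *m (X - a%:M) ^+ m = 0 -> sublinear_mx (fun n => v *m X ^+ n).
Proof.
move=> a1; elim: m v => [|m IHm] v.
  rewrite expr0 mulmx1 => ->; apply: (@sublinear_mx_ext _ _ _ (fun=> 0)).
    by move=> k; rewrite mul0mx.
  exact: sublinear_mx_cst.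
rewrite exprS -mulmxE mulmxA => /IHm sv i j.
apply: (sublinear_rec _ _ _ a1).
suff -> : (fun n => (v *m X ^+ n.+1) i j - a * (v *m X ^+ n) i j) =
  (fun n => (v *m (X - a%:M) *m X ^+ n) i j) by exact: sv.
apply/funext => n; rewrite mulmxBr mul_mx_scalar mulmxBl -scalemxAl exprS.
have subE (M N : 'rV[CC R]_d) : (M - a *: N) i j = M i j - a * N i j.
  by rewrite !mxE.
by rewrite -mulmxE mulmxA subE.
Qed.

Lemma sublinear_row_eigen (R : realType) (d : nat) (X : 'M[CC R]_d)
    (a : CC R) (v : 'rV[CC R]_d) :
  `|a| = 1 -> v *m X = a *: v -> sublinear_mx (fun n => v *m X ^+ n).
Proof.
move=> a1 vX i j e e0; exists `|v i j| => n.
rewrite (eigenvector_orbit _ _ _ _ _ _ vX) mxE normrM normrX a1 expr1n mul1r.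
by rewrite lerDl mulr_ge0 ?ler0n // ltW.
Qed.

Lemma sublinear_powers_spectrum (R : realType) (d : nat) (X : 'M[CC R]_d) :
  sublinear_mx (fun n => X ^+ n) <->
  (forall a, eigenvalue X a -> `|a| <= 1) /\
  (forall a, eigenvalue X a -> `|a| = 1 -> semisimple_at X a).
Proof.
split=> [sX|[le1 ss]].
  have svX (v : 'rV_d) : sublinear_mx (fun n => v *m X ^+ n).
    exact: sublinear_mxM.
  split=> a.
    move=> /eigenvalueP[v vX /rV0Pn[j vj]].
    apply: (sublinear_exp_le1 _ _ _ vj).
    suff <- : (fun n => (v *m X ^+ n) 0 j) = (fun n => a ^+ n * v 0 j) by exact: svX.
    by apply/funext => n; rewrite (eigenvector_orbit _ _ _ _ _ _ vX) mxE.
  move=> _ a1 w; set v := w *m _ => vXa; apply/eqP; apply: contraT.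
  move=> /rV0Pn[j vj]; exfalso.
  have wX : w *m X = a *: w + v by rewrite /v mulmxBr mul_mx_scalar addrC subrK.
  have vX : v *m X = a *: v.
    by apply/eqP; rewrite -subr_eq0 -mul_mx_scalar -mulmxBr vXa.
  (* [mxE] would otherwise expand the product that defines v. *)
  clearbody v.
  apply: (@linear_growth_not_sublinear R `|v 0 j| `|a * w 0 j| _ _ _
    (sublinearM _ a _ (svX w 0 j))); first by rewrite normr_gt0.
  move=> n; have /matrixP/(_ 0 j) := jordan_chain_orbit _ _ _ _ _ _ n wX vX.
  rewrite mxE => ->; rewrite !mxE [leRHS]normrM normrX a1 expr1n mul1r.
  rewrite [a * _ + _]addrC -[X in X * `|_| - _]normr_nat -normrM.
  exact: lerB_normD.
have svX : forall v : 'rV_d, sublinear_mx (fun n => v *m X ^+ n).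
  apply: (primary_ind _ _ X).
  - apply: (@sublinear_mx_ext _ _ _ (fun=> 0)); last exact: sublinear_mx_cst.
    by move=> k; rewrite mul0mx.
  - move=> u v su sv; apply: (@sublinear_mx_ext _ _ _
      (fun n => u *m X ^+ n + v *m X ^+ n)); last exact: sublinear_mxD.
    by move=> k; rewrite mulmxDl.
  move=> a m v Xa /kermxpoly_XsubCX vm.
  have := le1 _ Xa; rewrite le_eqVlt => /orP[/eqP a1|a1]; last first.
    exact: sublinear_row_inner a1 vm.
  apply: (sublinear_row_eigen _ _ _ _ _ a1).
  apply/eqP; rewrite -subr_eq0 -mul_mx_scalar -mulmxBr; apply/eqP.
  (* [ss] lowers the exponent of X - a killing v, down to 1. *)
  elim: m v vm => [|m IHm] v; first by rewrite expr0 mulmx1 => ->; rewrite mul0mx.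
  by rewrite exprS -mulmxE mulmxA => /IHm; exact: ss.
move=> i j; have := svX (delta_mx 0 i) 0 j.
by under eq_fun do rewrite -rowE mxE.
Qed.

(** * The Cesaro criterion *)

Lemma unitmx_one_sub (F : fieldType) (d : nat) (X : 'M[F]_d) :
  (1%:M - X \in unitmx) = ~~ eigenvalue X 1.
Proof.
rewrite /eigenvalue kermx_eq0 row_free_unit negbK -opprB.
by rewrite -scaleN1r unitmxZ ?unitrN1.
Qed.

Theorem proposition3p5 (R : realType) (d : nat) (X : 'M[CC R]_d) :
  ((1%:M - X \in unitmx) /\
   cesaro_summable (fun k => X ^+ k) (invmx (1%:M - X)))
  <->
  ((spectrum X `<=` closure (unit_disc R) `\ 1) /\
   (forall a : CC R,
      ((spectrum X `&` boundary (unit_disc R)) `\ 1) a ->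
      geometric_multiplicity X a = algebraic_multiplicity X a)).
Proof.
rewrite closure_unit_disc boundary_unit_disc /spectrum.
split=> [[Xu /(cesaro_summable_neumann _ _ _ Xu)] | [spec mult]].
  move=> /sublinear_powers_spectrum[le1 ss].
  split=> [a /= Xa|a [[/= Xa a1] _]]; last first.
    by apply/semisimple_at_mup; exact: ss.
  split; first exact: le1.
  by move=> a1; move: Xu; rewrite unitmx_one_sub -a1 Xa.
have Xu : 1%:M - X \in unitmx.
  by rewrite unitmx_one_sub; apply/negP => /spec[_]; apply.
split=> //; apply/(cesaro_summable_neumann _ _ _ Xu)/sublinear_powers_spectrum.
split=> [a /spec[]//|a Xa a1].
by apply/semisimple_at_mup; apply: mult; split=> //; have [] := spec _ Xa.
Qed.
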